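(* Let $(X,X_+,\mathcal{K},f)$ be an ordered Banach space with a base. Let $\Sigma(X)$ be the set of all Markov operators on $X$, and let $\Sigma(X)_{ue}$ be the set of all Markov operators $T$ on $X$ such that the corresponding discrete Markov chain $\{T^n\}$ is uniformly ergodic. Then $\Sigma(X)_{ue}$ is a norm dense and open subset of $\Sigma(X)$ (with respect to the operator norm).
   Context: Ordered Banach space with a base (OBSB) $(X,X_+,\mathcal{K},f)$: $X\neq\{0\}$ is a real ordered vector space with cone $X_+=\{x\in X: x\ge 0\}$ which is generating ($X=X_+-X_+$); $f$ is a linear functional on $X$ that is strictly positive ($f(x)>0$ whenever $x\in X_+$, $x\ne0$); $\mathcal{K}=\{x\in X_+: f(x)=1\}$ is the base. Let $U$ be the convex hull of $\mathcal{K}\cup(-\mathcal{K})$ and $\|x\|=\inf\{\lambda\ge 0: x\in\lambda U\}$. It is assumed that $U$ is linearly bounded (its intersection with every line is bounded), so that $\|\cdot\|$ is a norm, that $X$ is complete for this norm, and that $X_+$ is closed. All norms on $X$ are this norm, and norms of operators are the corresponding operator norms. A linear operator $T:X\to X$ is positive if $Tx\ge0$ whenever $x\ge 0$; a positive linear operator $T$ is Markov if $T(\mathcal{K})\subset\mathcal{K}$. For $y\in X$, $T_y:X\to X$ is the operator $T_y(x)=f(x)y$. The chain $\{T^n\}$ of a Markov operator $T$ is uniformly ergodic if there is $y_0\in X$ such that $\lim_{n\to\infty}\|T^n-T_{y_0}\|=0$. *)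

(* Defs.v *)
From HB Require Import structures.
From mathcomp Require Import all_boot all_order all_algebra.
From mathcomp Require Import all_classical all_reals all_analysis.

Set Implicit Arguments.
Unset Strict Implicit.
Unset Printing Implicit Defensive.

Import Order.TTheory GRing.Theory Num.Theory.
Import numFieldNormedType.Exports.

Local Open Scope classical_set_scope.
Local Open Scope ring_scope.

Definition convex_hull (R : realType) (X : lmodType R) (A : set X) : set X :=
  smallest (@convex_set R X) A.

Definition linearly_bounded (R : realType) (X : lmodType R) (A : set X) : Prop :=
  forall a d : X, d != 0 -> bounded_set [set t : R^o | A (a + t *: d)].

Section OrderedSpaceWithBase.
Variables (R : realType) (X : lmodType R).
Variables (le : X -> X -> Prop) (f : {scalar X}).

Record vector_order : Prop := VectorOrder {
  vle_refl : forall x, le x x;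
  vle_anti : forall x y, le x y -> le y x -> x = y;
  vle_trans : forall x y z, le x y -> le y z -> le x z;
  vle_add : forall x y z, le x y -> le (x + z) (y + z);
  vle_scale : forall (a : R) x y, 0 <= a -> le x y -> le (a *: x) (a *: y)
}.

Definition cone : set X := [set x | le 0 x].

Definition generating : Prop :=
  forall x, exists y z, [/\ cone y, cone z & x = y - z].

Definition strictly_positive : Prop :=
  forall x, cone x -> x != 0 -> 0 < f x.

Definition base : set X := [set x | cone x /\ f x = 1].

Definition base_unit : set X := convex_hull (base `|` -%R @` base).

Definition base_norm (x : X) : R :=
  inf [set lambda : R | 0 <= lambda /\ exists2 u, base_unit u & x = lambda *: u].

End OrderedSpaceWithBase.

(* An ordered Banach space with a base: the norm (and hence the topology) of
   the Banach space [X] is required to be the one generated by the base. *)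
Record obsb (R : realType) (X : completeNormedModType R)
    (le : X -> X -> Prop) (f : {scalar X}) : Prop := Obsb {
  obsb_nontrivial : exists x : X, x != 0;
  obsb_order : vector_order le;
  obsb_generating : generating le;
  obsb_strictly_positive : strictly_positive le f;
  obsb_linearly_bounded : linearly_bounded (base_unit le f);
  obsb_norm : forall x : X, `|x| = base_norm le f x;
  obsb_closed : closed (cone le)
}.

(* Extended-real valued, so that unbounded maps have norm +oo. *)
Definition opnorm (R : realType) (X Y : normedModType R) (T : X -> Y) : \bar R :=
  ereal_sup [set `|T x|%:E | x in [set x : X | `|x| <= 1]].

(* Linear operators on [X] with the topology of the operator norm. *)
Definition operator (R : realType) (X : normedModType R) : Type :=
  {linear X -> X}.

Identity Coercion linear_of_operator : operator >-> GRing.Linear.type.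

Section OperatorTopology.
Variables (R : realType) (X : normedModType R).

Definition operator_ball (S : operator X) (e : R) : set (operator X) :=
  [set T | (opnorm (S \- T)%R < e%:E)%E].

Lemma operator_ball_center (S : operator X) (e : R) :
  0 < e -> operator_ball S e S.
Proof.
move=> e0; rewrite /operator_ball /=; apply: (@le_lt_trans _ _ 0%E).
  by apply: ge_ereal_sup => _ [x _ <-]; rewrite /= subrr normr0.
by rewrite lte_fin.
Qed.

Lemma operator_ball_sym (S T : operator X) (e : R) :
  operator_ball S e T -> operator_ball T e S.
Proof.
rewrite /operator_ball /=; congr (_ < _)%E.
by rewrite /opnorm; congr ereal_sup; apply: eq_imagel => x _; rewrite distrC.
Qed.

Lemma operator_ball_triangle (S T U : operator X) (d e : R) :
  operator_ball S d T -> operator_ball T e U -> operator_ball S (d + e) U.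
Proof.
rewrite /operator_ball /= => ST TU.
apply: (@le_lt_trans _ _ (opnorm (S \- T)%R + opnorm (T \- U)%R)%E).
  apply: ge_ereal_sup => _ [x x1 <-] /=.
  apply: (@le_trans _ _ (`|S x - T x|%:E + `|T x - U x|%:E)%E).
    by rewrite -EFinD lee_fin ler_distD.
  by apply: leeD; apply: ereal_sup_ubound; exists x.
by rewrite EFinD; apply: lteD.
Qed.

HB.instance Definition _ := Choice.on (operator X).
HB.instance Definition _ :=
  hasNbhs.Build (operator X) (nbhs_ (entourage_ operator_ball)).
HB.instance Definition _ := Nbhs_isPseudoMetric.Build R (operator X)
  erefl operator_ball_center operator_ball_sym operator_ball_triangle erefl.

End OperatorTopology.

Section Markov.
Variables (R : realType) (X : normedModType R).
Variables (le : X -> X -> Prop) (f : {scalar X}).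

Definition positive_operator (T : operator X) : Prop :=
  forall x, le 0 x -> le 0 (T x).

Definition markov (T : operator X) : Prop :=
  positive_operator T /\ T @` base le f `<=` base le f.

Definition rank_one (y : X) : X -> X := fun x => f x *: y.

Definition uniformly_ergodic (T : operator X) : Prop :=
  exists y0 : X, opnorm (iter n T \- rank_one y0) @[n --> \oo] --> 0%E.

Definition Sigma : set (operator X) := [set T | markov T].

Definition Sigma_ue : set (operator X) :=
  [set T | markov T /\ uniformly_ergodic T].

(* The trace of [Sigma_ue] on [Sigma] seen as a type, which the library equips
   with the relative topology. *)
Definition Sigma_ue_in_Sigma : set (set_type Sigma) :=
  set_val @^-1` Sigma_ue.

End Markov.

Arguments Sigma_ue_in_Sigma {R X} le f _.

(* Main.v *)
Require Import Defs.
From HB Require Import structures.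
From mathcomp Require Import all_boot all_order all_algebra.
From mathcomp Require Import all_classical all_reals all_analysis.
From mathcomp Require Import lra.

Import Order.TTheory GRing.Theory Num.Theory.
Import numFieldNormedType.Exports.

Local Open Scope classical_set_scope.
Local Open Scope ring_scope.

(** Write [N] for the kernel of [f].  Two facts about the base norm are used:
    the unit ball is governed by the base, so a linear map that sends the base
    into a unit ball is a contraction ([linear_base_contraction]).  Hence [f]
    and every Markov operator have norm at most 1; moreover a Markov operator
    preserves [f], so it maps [N] into itself.

    Uniform ergodicity of [T] can then be read on [N]: it holds if and only if
    some power [T^n] is a strict contraction of [N].  If [T^n] tends to
    [x |-> f x *: y], the limit vanishes on [N], so that the norm of [T^n] on
    [N] is eventually below 1/2 ([ergodic_kernel_contraction]).  Conversely, a
    strict contraction of one power makes the norm of [T^m] on [N] tend to 0.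
    Differences of points of the base lie in [N], so for [k] in the base the
    orbit [T^m k] is Cauchy; its limit [y] satisfies
    [T^m x - f x *: y = T^m (x - f x *: k) + f x *: (T^m k - y)], where both
    terms are uniformly small ([kernel_contraction_ergodic]).

    The characterization involves a single power and a strict inequality.
    Since [S |-> S^n] is Lipschitz on Markov operators, it survives a small
    perturbation, whence openness.  For density, replace [T] by
    [(1 - e) T + e (x |-> f x *: k)] with [k] in the base: this Markov operator
    is at distance at most [2 e] from [T] and equals [(1 - e) T] on [N], where
    it is therefore a strict contraction. *)

(** * Operator norms *)

Section OperatorNorm.
Variables (R : realType) (X : normedModType R).
Implicit Types (T : X -> X) (e M : R).

Lemma opnorm_le T M :
  (forall x, `|x| <= 1 -> `|T x| <= M) -> (opnorm T <= M%:E)%E.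
Proof.
by move=> TM; apply: ge_ereal_sup => _ [x x1 <-]; rewrite lee_fin TM.
Qed.

Lemma opnorm_ge0 T : (0 <= opnorm T)%E.
Proof.
apply: (@le_trans _ _ `|T 0|%:E); first by rewrite lee_fin.
by apply: ereal_sup_ubound; exists 0 => //=; rewrite normr0.
Qed.

Lemma opnorm_lt_bound T M : linear T -> (opnorm T < M%:E)%E ->
  forall x, `|T x| <= M * `|x|.
Proof.
move=> Tlin TM x.
have TZ a y : T (a *: y) = a *: T y by exact: GRing.scalable_linear.
have [->|x0] := eqVneq x 0.
  by rewrite -(scale0r (0 : X)) TZ !scale0r !normr0 mulr0.
have nx0 : 0 < `|x| by rewrite normr_gt0.
have : (`|T (`|x|^-1 *: x)|%:E <= M%:E)%E.
  apply: le_trans (ltW TM); apply: ereal_sup_ubound.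
  exists (`|x|^-1 *: x) => //=.
  by rewrite normrZ normfV normr_id mulVf ?gt_eqF.
rewrite lee_fin TZ normrZ normfV normr_id mulrC ler_pdivrMr //.
Qed.

(** The operator norm is extended-real valued; being nonnegative, a sequence of
    norms converging to 0 is eventually finite, and the usual criterion
    holds. *)
Lemma opnorm_cvg0P (u : nat -> X -> X) :
  (opnorm (u n) @[n --> \oo] --> 0%E) <->
  (forall e, 0 < e -> \forall n \near \oo, (opnorm (u n) < e%:E)%E).
Proof.
split=> [/fine_cvgP[ufin /cvgrPdist_lt u0] e e0|u0].
  near=> n.
  have un : opnorm (u n) \is a fin_num by near: n.
  rewrite -(fineK un) lte_fin -[ltLHS]ger0_norm ?fine_ge0 ?opnorm_ge0 //.
  by rewrite -normrN -sub0r; near: n; apply: u0.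
have fin n e : (opnorm (u n) < e%:E)%E -> opnorm (u n) \is a fin_num.
  by move=> h; rewrite ge0_fin_numE ?opnorm_ge0 //; apply: lt_trans h (ltry _).
apply/fine_cvgP; split.
  by apply: filterS (u0 1 ltr01) => n; apply: fin.
apply/cvgrPdist_lt => e e0; apply: filterS (u0 e e0) => n h /=.
rewrite sub0r normrN ger0_norm ?fine_ge0 ?opnorm_ge0 //.
by rewrite -lte_fin fineK // (fin _ e).
Unshelve. all: by end_near. Qed.

End OperatorNorm.

Section IteratedOperator.
Variables (R : realType) (X : normedModType R) (T : operator X).

Lemma iter_linear n : linear (iter n T).
Proof. by elim: n => [|n IHn] a x y //=; rewrite IHn linearP. Qed.

Lemma iterB n x y : iter n T (x - y) = iter n T x - iter n T y.
Proof.
by rewrite addrC -scaleN1r iter_linear scaleN1r addrC.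
Qed.

End IteratedOperator.

(** * The base norm *)

Section BaseNorm.
Variables (R : realType) (X : completeNormedModType R).
Variables (le : X -> X -> Prop) (f : {scalar X}).
Hypothesis HX : obsb le f.

Local Notation K := (base le f).

Lemma base_scale x : cone le x -> x != 0 -> K ((f x)^-1 *: x).
Proof.
move=> xc x0; have fx := obsb_strictly_positive HX xc x0.
split; last by rewrite linearZ /= mulVf ?gt_eqF.
rewrite /cone /= -(scaler0 _ (f x)^-1).
by apply: vle_scale (obsb_order HX) _ _ _ _ xc; rewrite invr_ge0 ltW.
Qed.

Lemma base_nonempty : K !=set0.
Proof.
have [x x0] := obsb_nontrivial HX.
have [y [z [yc zc xyz]]] := obsb_generating HX x.
have [y0|y0] := eqVneq y 0; last by exists ((f y)^-1 *: y); apply: base_scale.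
have [z0|z0] := eqVneq z 0; last by exists ((f z)^-1 *: z); apply: base_scale.
by move: x0; rewrite xyz y0 z0 subrr eqxx.
Qed.

Lemma cone_ge0 x : cone le x -> 0 <= f x.
Proof.
move=> xc; have [->|x0] := eqVneq x 0; first by rewrite linear0.
exact/ltW/(obsb_strictly_positive HX).
Qed.

Lemma base_subset_unit : K `<=` base_unit le f.
Proof.
by apply: subset_trans (@sub_gen_smallest _ _ _); apply: subsetUl.
Qed.

(** A closed ball is convex and symmetric, so its preimage under [g] is a
    convex set containing the base and its opposite. *)
Lemma base_unit_le1 (Y : normedModType R) (g : X -> Y) : linear g ->
  (forall k, K k -> `|g k| <= 1) -> forall u, base_unit le f u -> `|g u| <= 1.
Proof.
move=> glin gK; apply: (@smallest_sub _ _ _ [set u | `|g u| <= 1]).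
  move=> x y t /set_mem /= gx /set_mem /= gy; apply/mem_set => /=.
  have -> : conv t x y = t%:num *: x + (1 - t%:num) *: y by [].
  rewrite glin (GRing.scalable_linear glin) /=.
  have t0 : 0 <= t%:num by [].
  have t1 : t%:num <= 1 by [].
  apply: le_trans (ler_normD _ _) _; rewrite !normrZ ger0_norm //.
  rewrite (@ger0_norm _ (1 - _)) ?subr_ge0 //.
  nra.
move=> k [/gK//|[k' /gK gk' <-]] /=.
by rewrite -scaleN1r (GRing.scalable_linear glin) /= scaleN1r normrN.
Qed.

(** The infimum defining the base norm need not be attained, so estimates with
    this norm are made up to an arbitrary [e]. *)
Lemma norm_gauge_lt x e : 0 < e ->
  exists l u, [/\ 0 <= l, l < `|x| + e, base_unit le f u & x = l *: u].
Proof.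
move=> e0.
set G := [set l : R | 0 <= l /\ exists2 u, base_unit le f u & x = l *: u].
(* The infimum of an empty set is 0 by convention: if [G] were empty then [x]
   would have norm 0, and [0 = 0 *: k] would put 0 in [G]. *)
have nG : G !=set0.
  apply: contrapT => /set0P/negP/negPn/eqP GE.
  have x0 : x = 0.
    by apply/normr0_eq0; rewrite (obsb_norm HX) /base_norm -/G GE inf0.
  have [k Kk] := base_nonempty.
  suff : G 0 by rewrite GE.
  by split=> //; exists k; [exact: base_subset_unit|rewrite scale0r].
have iG : has_inf G by split=> //; exists 0 => l [].
have [l [l0 [u Uu xlu]] le_l] := inf_adherent e0 iG.
by exists l, u; split=> //; rewrite (obsb_norm HX).
Qed.

(** Apart from its boundary, the unit ball is the convex hull of the base and
    its opposite, so norms of linear maps can be tested on the base. *)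
Lemma linear_base_contraction (Y : normedModType R) (g : X -> Y) : linear g ->
  (forall k, K k -> `|g k| <= 1) -> forall x, `|g x| <= `|x|.
Proof.
move=> glin gK x; apply/ler_addgt0Pr => e e0.
have [l [u [l0 lx Uu xlu]]] := norm_gauge_lt x _ e0.
rewrite {1}xlu (GRing.scalable_linear glin) /= normrZ ger0_norm //.
have := base_unit_le1 _ _ glin gK _ Uu.
nra.
Qed.

Lemma norm_base_le1 k : K k -> `|k| <= 1.
Proof.
move=> Kk; rewrite (obsb_norm HX); apply: ge_inf; first by exists 0 => l [].
by split=> //; exists k; [exact: base_subset_unit|rewrite scale1r].
Qed.

Lemma norm_functional_le x : `|f x| <= `|x|.
Proof.
have /(_ R^o (f : X -> R^o)) := linear_base_contraction; apply.
  by move=> a u v; rewrite linearP.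
by move=> k [_ fk]; rewrite fk normr1.
Qed.

(** * Markov operators *)

(** [f] and [f \o T] agree on the base, hence on the cone by scaling, hence
    everywhere since the cone is generating. *)
Lemma markov_functional T : Defs.markov le f T -> forall x, f (T x) = f x.
Proof.
move=> [_ TK] x.
have fT y : cone le y -> f (T y) = f y.
  move=> yc; have [->|y0] := eqVneq y 0; first by rewrite !linear0.
  have fy := obsb_strictly_positive HX yc y0.
  have [_] : K (T ((f y)^-1 *: y)).
    by apply: TK; exists ((f y)^-1 *: y) => //; exact: base_scale.
  by rewrite !linearZ /= mulrC => /divr1_eq.
have [y [z [yc zc ->]]] := obsb_generating HX x.
by rewrite !linearB /= !fT.
Qed.

Lemma iter_markov T n : Defs.markov le f T -> forall k, K k -> K (iter n T k).
Proof.
move=> [_ TK]; elim: n => //= n IHn k Kk; apply: TK.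
by exists (iter n T k) => //; exact: IHn.
Qed.

Lemma iter_functional T n : Defs.markov le f T ->
  forall x, f (iter n T x) = f x.
Proof. by move=> Tm x; elim: n => //= n IHn; rewrite markov_functional. Qed.

Lemma norm_iter_markov T n : Defs.markov le f T ->
  forall x, `|iter n T x| <= `|x|.
Proof.
move=> Tm; apply: linear_base_contraction; first exact: iter_linear.
by move=> k Kk; apply/norm_base_le1/iter_markov.
Qed.

(** * Ergodicity and strict contraction of the kernel of the functional *)

(** For [c < 1] this bounds the ergodicity (Dobrushin) coefficient of [T^n]. *)
Definition kernel_contraction (T : operator X) n (c : R) :=
  forall x, f x = 0 -> `|iter n T x| <= c * `|x|.

(** Powers of [T^n] contract the kernel geometrically, and the remaining
    iterations do not increase the norm. *)
Lemma kernel_contraction_decay T n c : Defs.markov le f T -> c < 1 -> 0 <= c ->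
  kernel_contraction T n c -> forall e, 0 < e ->
  exists M, forall m, (M <= m)%N -> kernel_contraction T m e.
Proof.
move=> Tm c1 c0 Tc e e0.
have powc q x : f x = 0 -> `|iter (q * n) T x| <= c ^+ q * `|x|.
  move=> fx; elim: q => [|q IHq]; first by rewrite expr0 mul1r.
  rewrite mulSn iterD exprS -mulrA.
  apply: le_trans (Tc _ _) _; first by rewrite iter_functional.
  by rewrite ler_wpM2l.
have [q _ /(_ q (leqnn q)) /= cq] : \forall q \near \oo, c ^+ q < e.
  have /cvgrPdist_lt/(_ e e0) : (fun q => c ^+ q) @ \oo --> (0 : R).
    by apply: cvg_expr; rewrite ger0_norm.
  by apply: filterS => q; rewrite sub0r normrN ger0_norm // exprn_ge0.
exists (q * n)%N => m /subnKC <- x fx; rewrite iterD.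
apply: le_trans (powc _ _ _) _; first by rewrite iter_functional.
apply: ler_pM => //; [exact: exprn_ge0|exact: ltW|exact: norm_iter_markov].
Qed.

(** The difference of two points of the base is in the kernel of [f] and has
    norm at most 2. *)
Lemma kernel_contraction_base T m e k k' : 0 <= e -> kernel_contraction T m e ->
  K k -> K k' -> `|iter m T k - iter m T k'| <= e * 2.
Proof.
move=> e0 Te Kk Kk'; rewrite -iterB.
apply: le_trans (Te _ _) _.
  by rewrite linearB /= Kk.2 Kk'.2 subrr.
rewrite ler_wpM2l // (le_trans (ler_normB _ _)) //.
by have := norm_base_le1 _ Kk; have := norm_base_le1 _ Kk'; lra.
Qed.

(** The orbit of a point of the base is Cauchy because a tail of it is the
    image under [T^M] of points of the base; its limit gives the rank one
    limit of the powers of [T]. *)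
Lemma kernel_contraction_ergodic T n c :
  Defs.markov le f T -> c < 1 -> 0 <= c ->
  kernel_contraction T n c -> uniformly_ergodic f T.
Proof.
move=> Tm c1 c0 Tc.
have decay := kernel_contraction_decay _ _ _ Tm c1 c0 Tc.
have [k Kk] := base_nonempty.
pose u m := iter m T k.
have KT j : K (iter j T k) by apply: iter_markov.
have udist e M m : 0 <= e -> kernel_contraction T M e -> (M <= m)%N ->
    `|u M - u m| <= e * 2.
  move=> e0 TM /subnKC <-; rewrite /u iterD.
  exact: kernel_contraction_base.
have /cauchy_cvgP/cvg_ex[/= y uy] : cauchy (u @ \oo).
  apply: cauchy_exP => e e0.
  have e3 : 0 < e / 3 by lra.
  have [M HM] := decay _ e3.
  exists (u M); exists M => // m /= Mm; rewrite -ball_normE /=.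
  apply: le_lt_trans (udist _ _ _ (ltW e3) (HM _ (leqnn _)) Mm) _; lra.
exists y; apply/opnorm_cvg0P => e e0.
have e5 : 0 < e / 5 by lra.
have [M HM] := decay _ e5.
exists M => // m /= /HM Tme.
have um : `|u m - y| <= e / 5 * 2.
  have : `|u m - u j| @[j --> \oo] --> `|u m - y|.
    by apply: cvg_norm; apply: cvgB uy; exact: cvg_cst.
  move/cvgr_to_le; apply.
  by exists m => // j /=; apply: udist => //; exact: ltW.
apply: (@le_lt_trans _ _ (e / 5 * 4)%:E); last by rewrite lte_fin; lra.
apply: opnorm_le => x x1; rewrite /rank_one /=.
have fx : `|f x| <= 1 := le_trans (norm_functional_le x) x1.
have -> : iter m T x - f x *: y = iter m T (x - f x *: k) + f x *: (u m - y).
  rewrite iterB scalerBr addrA; congr (_ - _).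
  by rewrite -[f x *: k]addr0 iter_linear -(subrr 0) iterB subrr addr0 subrK.
apply: le_trans (ler_normD _ _) _; rewrite normrZ.
have := Tme (x - f x *: k).
rewrite linearB linearZ /= Kk.2 mulr1 subrr => /(_ erefl) h.
have : `|x - f x *: k| <= 2.
  apply: le_trans (ler_normB _ _) _; rewrite normrZ.
  have := norm_base_le1 _ Kk; have := normr_ge0 k; have := normr_ge0 (f x); nra.
have := normr_ge0 (u m - y); have := normr_ge0 (f x).
move: `|x - _| `|iter _ _ _| h => a b h; nra.
Qed.

(** A rank one limit [x |-> f x *: y] vanishes on the kernel of [f]. *)
Lemma ergodic_kernel_contraction T : uniformly_ergodic f T ->
  exists n, kernel_contraction T n (1 / 2).
Proof.
move=> [y /opnorm_cvg0P/(_ (1/2))].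
case; [lra|] => n _ /(_ n (leqnn n)) /= h; exists n => x fx.
have : linear (iter n T \- rank_one f y).
  move=> a u v /=; rewrite /rank_one iter_linear linearP /= scalerBr scalerA.
  by rewrite scalerDl opprD addrACA.
move=> /opnorm_lt_bound/(_ h x).
by rewrite /= /rank_one fx scale0r subr0.
Qed.

(** * Perturbation of Markov operators and openness *)

(** Telescoping: [S^n.+1 - T^n.+1 = S (S^n - T^n) + (S - T) T^n]. *)
Lemma iter_markov_dist S T d n :
  Defs.markov le f S -> Defs.markov le f T -> 0 <= d ->
  (forall x, `|S x - T x| <= d * `|x|) ->
  forall x, `|iter n S x - iter n T x| <= n%:R * d * `|x|.
Proof.
move=> Sm Tm d0 ST x; elim: n => [|n IHn].
  by rewrite /= subrr normr0 !mul0r.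
rewrite /= -[X in `|X|](subrKA (S (iter n T x))) -linearB.
apply: le_trans (ler_normD _ _) _.
have := norm_iter_markov _ 1 Sm (iter n S x - iter n T x).
have := ST (iter n T x).
have := ler_wpM2l d0 (norm_iter_markov _ n Tm x).
rewrite /= -natr1; lra.
Qed.

Lemma kernel_contraction_perturb S T d n c :
  Defs.markov le f S -> Defs.markov le f T -> 0 <= d ->
  (forall x, `|S x - T x| <= d * `|x|) -> kernel_contraction T n c ->
  kernel_contraction S n (n%:R * d + c).
Proof.
move=> Sm Tm d0 ST Tc x fx.
rewrite -[iter n S x](subrK (iter n T x)) mulrDl.
apply: le_trans (ler_normD _ _) _.
by apply: lerD; [exact: iter_markov_dist|exact: Tc].
Qed.

Lemma Sigma_ue_open : open (Sigma_ue_in_Sigma le f).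
Proof.
rewrite openE => -[T TS] [/= Tm /ergodic_kernel_contraction[n Tn]].
(* The [n]-th powers differ by at most [n d <= 1/4], so the constant 1/2 for [T]
   becomes at most 3/4 for [S]; [n.+1] avoids a division by zero. *)
pose d : R := 1 / (4 * n.+1%:R).
have n0 : 0 < n.+1%:R :> R by rewrite ltr0n.
have d0 : 0 < d by rewrite divr_gt0 // mulr_gt0.
have nd : n%:R * d <= 1 / 4.
  rewrite /d mul1r invfM mulrCA mul1r ler_piMr // ?invr_ge0 //.
  by rewrite ler_pdivrMr // mul1r ler_nat.
have : nbhs (exist _ T TS : set_type (Sigma le f)) (set_val @^-1` ball T d).
  apply: (@initial_continuous (set_type (Sigma le f)) _ set_val).
  exact: nbhsx_ballx.
apply: filterS => -[S SS] /= dS.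
have Sm : Defs.markov le f S := set_mem SS.
split=> //=.
have ST x : `|S x - T x| <= d * `|x|.
  rewrite distrC; apply: (@opnorm_lt_bound _ _ (T \- S)%R) dS x.
  move=> a u v /=; rewrite [S _]linearP [T _]linearP /=.
  by rewrite scalerBr opprD addrACA.
have Sn := kernel_contraction_perturb _ _ _ _ _ Sm Tm (ltW d0) ST Tn.
apply: kernel_contraction_ergodic Sm _ _ Sn.
  lra.
by rewrite addr_ge0 // mulr_ge0 // ltW.
Qed.

(** * Density *)

(** At each step the chain is restarted from [k] with probability [e]. *)
Definition resetting (T : operator X) (e : R) (k x : X) : X :=
  (1 - e) *: T x + (e * f x) *: k.

Lemma resetting_linear T e k : linear (resetting T e k).
Proof.
move=> a x y; rewrite /resetting [T _]linearP [f _]linearP /=.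
rewrite mulrDr [X in _ + X]scalerDl !scalerDr !scalerA addrACA.
by rewrite [(1 - e) * a]mulrC [e * (a * _)]mulrCA.
Qed.

HB.instance Definition _ T e k :=
  GRing.isLinear.Build R X X *:%R (resetting T e k) (resetting_linear T e k).

Definition resetting_operator T e k : operator X := resetting T e k.

Lemma resetting_markov T e k : Defs.markov le f T -> 0 <= e <= 1 -> K k ->
  Defs.markov le f (resetting_operator T e k).
Proof.
move=> Tm /andP[e0 e1] Kk; have Ho := obsb_order HX.
have pos : positive_operator le (resetting_operator T e k).
  move=> x x0; rewrite /= /resetting.
  apply: (vle_trans Ho) (_ : le (0 + (e * f x) *: k) _).
    rewrite add0r -[X in le X](scaler0 _ (e * f x)).
    by apply: (vle_scale Ho); [rewrite mulr_ge0 // cone_ge0|exact: Kk.1].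
  apply: (vle_add Ho); rewrite -[X in le X](scaler0 _ (1 - e)).
  by apply: (vle_scale Ho); [rewrite subr_ge0|exact: Tm.1].
split=> // _ [x [x0 fx] <-]; split; first exact: pos.
rewrite /= /resetting linearD !linearZ /= markov_functional // fx Kk.2; lra.
Qed.

(** On the kernel of [f] the restart term vanishes, so the operator is
    [(1 - e) T] there and contracts in one step. *)
Lemma resetting_ergodic T e k : Defs.markov le f T -> 0 < e <= 1 -> K k ->
  uniformly_ergodic f (resetting_operator T e k).
Proof.
move=> Tm /andP[e0 e1] Kk.
apply: (kernel_contraction_ergodic _ 1 (1 - e)); [|lra|lra|].
  by apply: resetting_markov => //; rewrite ltW.
move=> x fx; rewrite /= /resetting fx mulr0 scale0r addr0 normrZ.
rewrite ger0_norm ?subr_ge0 // ler_wpM2l ?subr_ge0 //.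
exact: (norm_iter_markov _ 1 Tm).
Qed.

Lemma resetting_dist T e k : Defs.markov le f T -> 0 <= e -> K k ->
  (opnorm (T \- resetting_operator T e k)%R <= (e * 2)%:E)%E.
Proof.
move=> Tm e0 Kk; apply: opnorm_le => x x1 /=.
have -> : T x - resetting T e k x = e *: (T x - f x *: k).
  by rewrite /resetting scalerBl scale1r scalerBr scalerA opprD addrA subKr.
rewrite normrZ ger0_norm // ler_wpM2l // (le_trans (ler_normB _ _)) // normrZ.
have := norm_iter_markov _ 1 Tm x; have := norm_functional_le x.
have := norm_base_le1 _ Kk; have := normr_ge0 k; have := normr_ge0 (f x).
rewrite /=; nra.
Qed.

Lemma Sigma_ue_dense : dense (Sigma_ue_in_Sigma le f).
Proof.
move=> O [[T TS] BT] [B oB BO]; move: BT; rewrite -BO => BT.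
have Tm : Defs.markov le f T := set_mem TS.
have /nbhs_ballP[r /= r0 rB] : nbhs T B by apply: open_nbhs_nbhs; split.
have [k Kk] := base_nonempty.
pose e := Num.min 1 (r / 4).
have e0 : 0 < e by rewrite lt_min ltr01 /=; lra.
have e1 : e <= 1 by rewrite ge_min lexx.
have er : e <= r / 4 by rewrite ge_min lexx orbT.
have Sm : Defs.markov le f (resetting_operator T e k).
  by apply: resetting_markov => //; rewrite ltW.
exists (exist _ (resetting_operator T e k) (mem_set Sm)); split.
  apply: rB; apply: (@le_lt_trans _ _ (e * 2)%:E).
    by apply: resetting_dist => //; exact: ltW.
  by rewrite lte_fin; lra.
split=> //; apply: resetting_ergodic => //.
by rewrite e0.
Qed.

End BaseNorm.

Theorem theorem3p7 (R : realType) (X : completeNormedModType R)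
    (le : X -> X -> Prop) (f : {scalar X}) (HX : obsb le f) :
  [/\ Sigma_ue le f `<=` Sigma le f,
      dense (Sigma_ue_in_Sigma le f) &
      open (Sigma_ue_in_Sigma le f)].
Proof.
split; first by move=> T [].
- exact: Sigma_ue_dense.
- exact: Sigma_ue_open.
Qed.
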